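(* Assume that $\theta\in\mathbb{R}$, $\varphi\in\mathcal{C}^1(E,\mathbb{R})$ and $\Upsilon\subset M$ is a closed set. Let $$\Gamma:=\left\{\gamma\in\mathcal{C}([0,1],M):\gamma(0)\in\Upsilon,\ \varphi(\gamma(1))<\theta\right\}.$$ If $\varphi$ satisfies $$a:=\inf_{\gamma\in\Gamma}\max_{t\in[0,1]}\varphi(\gamma(t))>b:=\sup_{\gamma\in\Gamma}\max\{\varphi(\gamma(0)),\varphi(\gamma(1))\},$$ then, for every $\varepsilon\in(0,(a-b)/2)$, $\delta>0$ and $\hat\gamma\in\Gamma$ such that $\sup_{t\in[0,1]}\varphi(\hat\gamma(t))\le a+\varepsilon$, there exists $u\in M$ such that (i) $a-2\varepsilon\le\varphi(u)\le a+2\varepsilon$; (ii) $\min_{t\in[0,1]}\|u-\hat\gamma(t)\|_E\le2\delta$; (iii) $\left\|\varphi|_M'(u)\right\|\le\frac{8\varepsilon}\delta$.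
   Context: $H$ is a real Hilbert space with scalar product $(\cdot,\cdot)_H$ and norm $\|\cdot\|_H$, $E$ is a real Banach space with norm $\|\cdot\|_E$, both infinite dimensional, with continuous injections $E\hookrightarrow H\hookrightarrow E^*$ ($E^*$ the dual of $E$, $H$ identified with its dual). $M:=\{u\in E:\|u\|_H=1\}$ with the topology inherited from $E$; its tangent space at $u\in M$ is $T_uM=\{v\in E:(u,v)_H=0\}$. For $\varphi\in\mathcal{C}^1(E,\mathbb{R})$ and $u\in M$, $\|\varphi|_M'(u)\|:=\sup\{|\langle\varphi'(u),v\rangle|:v\in T_uM,\ \|v\|_E=1\}$. *)

(* Defs.v *)
From HB Require Import structures.
From mathcomp Require Import all_boot all_order all_algebra.
From mathcomp Require Import all_classical all_reals all_analysis.

Set Implicit Arguments.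
Unset Strict Implicit.
Unset Printing Implicit Defensive.

Import Order.TTheory GRing.Theory Num.Theory.
Import numFieldNormedType.Exports.

Local Open Scope classical_set_scope.
Local Open Scope ring_scope.

Definition infinite_dimensional (R : realType) (V : lmodType R) : Prop :=
  forall s : seq V, exists v : V,
    forall c : 'I_(size s) -> R, v <> \sum_(k < size s) c k *: s`_k.

(* [differentiable] is Frechet differentiability, with a continuous
   differential; the second conjunct is continuity of the differential for the
   operator norm of the dual of [E]. *)
Definition C1 (R : realType) (E : normedModType R) (phi : E -> R^o) : Prop :=
  (forall u : E, differentiable phi u) /\
  (forall u : E, forall e : R, 0 < e ->
     \forall w \near u, forall v : E,
       `|'d phi w v - 'd phi u v| <= e * `|v|).

Section Constraint.
Variables (R : realType) (E H : normedModType R).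
Variables (ip : {dot H for idfun}) (j : {linear E -> H}).

(* The map H -> E^* obtained by transposing [j] and identifying H with its
   dual through the scalar product. *)
Definition to_dual (h : H) : E -> R := fun v => ip h (j v).

Definition sphere : set E := [set u | `|j u| = 1].

Definition tangent (u : E) : set E := [set v | ip (j u) (j v) = 0].

Definition norm_constrained_diff (phi : E -> R^o) (u : E) : \bar R :=
  ereal_sup [set (`|'d phi u v|)%:E | v in [set v | tangent u v /\ `|v| = 1]].

(* A path is represented by a total function on [R], of which only the values
   on [0, 1] matter. *)
Definition paths (phi : E -> R^o) (theta : R) (Y : set E) : set (R -> E) :=
  [set gamma : R -> E | [/\ {within `[0, 1], continuous gamma},
                   (forall t : R, 0 <= t <= 1 -> sphere (gamma t)),
                   Y (gamma 0) & phi (gamma 1) < theta]].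

(* For a continuous path this supremum is a maximum, [0, 1] being compact. *)
Definition max_on_path (phi : E -> R^o) (gamma : R -> E) : \bar R :=
  ereal_sup [set (phi (gamma t))%:E | t in `[0, 1]].

(* For a continuous path this infimum is a minimum, [0, 1] being compact. *)
Definition min_dist_path (u : E) (gamma : R -> E) : \bar R :=
  ereal_inf [set (`|u - gamma t|)%:E | t in `[0, 1]].

(* Extended real valued, so that the infimum over an empty set of paths is
   +oo. *)
Definition minimax_level (phi : E -> R^o) (theta : R) (Y : set E) : \bar R :=
  ereal_inf [set max_on_path phi gamma | gamma in paths phi theta Y].

Definition endpoint_level (phi : E -> R^o) (theta : R) (Y : set E) : \bar R :=
  ereal_sup [set (Num.max (phi (gamma 0)) (phi (gamma 1)))%:E
            | gamma in paths phi theta Y].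

End Constraint.

(* Main.v *)
Require Import Defs.
From HB Require Import structures.
From mathcomp Require Import all_boot all_order all_algebra.
From mathcomp Require Import ring lra.
From mathcomp Require Import all_classical all_reals all_analysis.

Set Implicit Arguments.
Unset Strict Implicit.
Unset Printing Implicit Defensive.

Import Order.TTheory GRing.Theory Num.Theory.
Import numFieldNormedType.Exports.

Local Open Scope classical_set_scope.
Local Open Scope ring_scope.

(** The point [u] is found on a path near [gamma] that is almost minimal, in
    the sense of Ekeland, for the maximum of [phi] along paths.

    Let [p] and [q] be the endpoints of the given path [gamma] and consider the
    continuous curves on the sphere from [p] to [q], with the functional
    [path_max phi].  All of them are competitors in the definition of [a], so
    the functional is at least [a] on them, and it is at most [a + eps] at
    [gamma].  Ekeland's variational principle, in the form of the
    Brezis-Browder ordering principle ([brezis_browder]) applied to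
    [path_order k] with [k = eps / (2 * delta)], yields a curve [g] at uniform
    distance at most [eps / k = 2 * delta] from [gamma] that cannot be improved
    at a rate [k]: a competitor [f] with
    [`|f t - g t| <= (path_max phi g - path_max phi f) / k] for all [t] has
    [path_max phi g <= path_max phi f].  Completeness of [E] enters through
    [curves_chain_complete].

    Put [P = path_max phi g], so [a <= P <= a + eps].  At every time [t] with
    [phi (g t) = P] the point [u = g t] has the required level and distance to
    [gamma].  If the bound on the constrained differential failed at all these
    points, each would have a tangent unit vector along which [phi] decreases
    at a rate more than [m = 8 * eps / delta].  The conditions
    expected from a descent direction are convex and stable under small
    changes of the point, so these vectors can be replaced by one continuous
    tangent field [w] along [g], of norm less than 2 and zero at the two ends
    ([tangent_descent_field], by gluing on the interval:
    [continuous_convex_selection]).  Here it matters that [p] and [q] lie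
    strictly below the level [P], because [b < a].  The curve
    [g + h *: w], brought back to the sphere by dividing by the norm of its
    image in [H], has velocity [w] at [h = 0], since tangency makes the
    correction quadratic in [h] ([radial_retraction_velocity]).  By compactness
    of the interval, for small [h > 0] it stays within [2 * h] of [g] while its
    maximum is at most [P - m / 2 * h] ([perturbed_path_descent]).  As
    [m / 2 = 8 * k], this beats the rate [k], which is absurd. *)

(** * Projection onto the unit interval *)

Definition clamp01 (R : realType) (t : R) : R := Num.min 1 (Num.max 0 t).

Lemma clamp01_itv (R : realType) (t : R) : 0 <= clamp01 t <= 1.
Proof. by rewrite /clamp01 le_min ler01 le_max lexx /= ge_min lexx. Qed.

Lemma clamp01_le0 (R : realType) (t : R) : t <= 0 -> clamp01 t = 0.
Proof. by move=> t0; rewrite /clamp01 max_l ?min_r ?ler01. Qed.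

Lemma clamp01_ge1 (R : realType) (t : R) : 1 <= t -> clamp01 t = 1.
Proof. by move=> t1; rewrite /clamp01 min_l // le_max t1 orbT. Qed.

Lemma clamp01_id (R : realType) (t : R) : 0 <= t <= 1 -> clamp01 t = t.
Proof. by move=> /andP[t0 t1]; rewrite /clamp01 max_r // min_r. Qed.

Lemma continuous_clamp01 (R : realType) : continuous (@clamp01 R).
Proof.
have cst (c : R) : continuous (fun _ : R => c) by exact: cst_continuous.
have cid : continuous (fun x : R => x) by move=> x; exact: cvg_id.
exact: (min_fun_continuous (cst 1) (max_fun_continuous (cst 0) cid)).
Qed.

(** * The Brezis-Browder ordering principle *)

(** Descend greedily: pick [u n.+1] below [u n] with [F (u n.+1)] within
    [1 / n.+1] of the infimum of [F] below [u n].  Anything below a lower bound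
    [y] of this chain is below every [u n], so its value is at least all those
    infima up to [1 / n.+1], hence at least [F y]. *)
Lemma brezis_browder (R : realType) (T : Type) (A : set T)
    (le : T -> T -> Prop) (F : T -> R) (m : R) (x0 : T) :
  (forall x, le x x) -> (forall y x z, le x y -> le y z -> le x z) ->
  (forall x, A x -> m <= F x) -> (forall x y, le x y -> F x <= F y) ->
  (forall u : nat -> T, (forall n, A (u n)) -> (forall n, le (u n.+1) (u n)) ->
     exists2 y, A y & forall n, le y (u n)) ->
  A x0 ->
  exists x, [/\ A x, le x x0 & forall y, A y -> le y x -> F x <= F y].
Proof.
move=> lerefl letrans Fge_m F_mono chain Ax0.
pose below x := [set y | A y /\ le y x].
have lbF x : has_lbound (F @` below x).
  by exists m => _ [y [Ay _] <-]; exact: Fge_m.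
have step (p : T * nat) : exists y, A p.1 ->
    [/\ A y, le y p.1 & F y < inf (F @` below p.1) + p.2.+1%:R^-1].
  have [Ap|nAp] := pselect (A p.1); last by exists p.1.
  have [||_ [y [Ay yp] <-] Fy] :=
      @inf_adherent _ (F @` below p.1) p.2.+1%:R^-1.
  - by rewrite invr_gt0.
  - by split=> //; exists (F p.1), p.1.
  by exists y.
have [next nextP] := choice step.
pose u := fix u n := if n is k.+1 then next (u k, k) else x0.
have Au n : A (u n) by elim: n => //= n /(nextP (u n, n)) [].
have le_u n : le (u n.+1) (u n) by case: (nextP (u n, n) (Au n)).
have [y Ay yu] := chain u Au le_u.
exists y; split=> // [|z Az zy]; first exact: (yu 0).
rewrite leNgt; apply/negP => /ltr_add_invr [k].
apply/negP; rewrite -leNgt.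
have [_ _ /ltW Fuk] := nextP (u k, k) (Au k).
apply: (le_trans (F_mono _ _ (yu k.+1))); apply: (le_trans Fuk).
rewrite lerD2r.
apply: ge_inf => //; exists z => //; split=> //.
exact: letrans zy (yu k).
Qed.

(** * Continuous selections on an interval *)

(** On an interval, local selections can be glued from left to right: a
    selection on [[a, s]] and one defined near [s] are interpolated on a short
    interval ending at [s], where convexity of [G t] applies.  Hence the
    supremum of the [s] reached cannot be less than [b]. *)
Lemma continuous_convex_selection (R : realType) (V : normedModType R)
    (G : R -> set V) (a b : R) :
  (forall t x y l, G t x -> G t y -> 0 <= l <= 1 ->
     G t ((1 - l) *: x + l *: y)) ->
  (forall t0 : R, exists2 v : R -> V,
     continuous v & \forall t \near t0, G t (v t)) ->
  exists2 w : R -> V, continuous w & forall t, a <= t <= b -> G t (w t).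
Proof.
move=> convG locG.
pose S := [set s | exists2 w : R -> V,
  continuous w & forall t, a <= t <= s -> G t (w t)].
suff : S b by [].
apply: contrapT => nSb.
have Sdown s s' : S s -> s' <= s -> S s'.
  move=> [w cw Gw] s's; exists w => // t /andP[at_ ts'].
  by apply: Gw; rewrite at_ (le_trans ts').
have Sa : S a.
  have [v cv /nbhs_singleton Gv] := locG a.
  by exists v => // t; rewrite -eq_le => /eqP <-.
have hasS : has_sup S.
  split; first by exists a.
  by exists b => s Ss; rewrite leNgt; apply/negP => /ltW /(Sdown _ _ Ss).
pose c := sup S.
have [v cv /nbhs_ballP[r /= r0 Gv]] := locG c.
have {}Gv t : c - r < t < c + r -> G t (v t).
  by move=> tr; apply: Gv; rewrite /ball /= ltr_distlC.
have r20 : 0 < r / 2 by rewrite divr_gt0.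
have [s [w cw Gw] cs] := sup_adherent r20 hasS.
pose m := c - r / 2.
have ms : m < s by [].
have sc : s <= c by apply: ub_le_sup; [case: hasS | exists w].
(* The glued selection follows [w] up to [m] and [v] from [s] on. *)
pose l t := clamp01 ((t - m) / (s - m)).
have cl : continuous l.
  move=> t; apply: (@continuous_comp _ _ _ (fun t => (t - m) / (s - m))).
    by apply: cvgMl; apply: cvgB; [exact: cvg_id | exact: cvg_cst].
  exact: continuous_clamp01.
suff : S (c + r / 2).
  move=> /(ub_le_sup (proj2 hasS)); rewrite -/c leNgt ltrDl.
  by rewrite r20.
exists (fun t => (1 - l t) *: w t + l t *: v t).
  move=> t; apply: cvgD.
    by apply: cvgZ; [apply: cvgB; [exact: cvg_cst|exact: cl] | exact: cw].
  by apply: cvgZ; [exact: cl | exact: cv].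
have sm0 : 0 < s - m by rewrite subr_gt0.
move=> t /andP[at_ tc].
have [tm|mt] := leP t m.
  have -> : l t = 0.
    by rewrite /l clamp01_le0 // ler_pdivrMr // mul0r subr_le0.
  rewrite subr0 scale1r scale0r addr0; apply: Gw.
  by rewrite at_ (le_trans tm) // ltW.
have Gvt : G t (v t).
  apply: Gv; move: mt tc r0; rewrite /m; clear; move=> *; lra.
have [st|ts] := leP s t.
  have -> : l t = 1.
    by rewrite /l clamp01_ge1 // ler_pdivlMr // mul1r lerD2r.
  by rewrite subrr scale0r scale1r add0r.
apply: convG => //; first by apply: Gw; rewrite at_ ltW.
exact: clamp01_itv.
Qed.

(** * Strict differentiability *)

Lemma is_derive_along_segment (R : realType) (E : normedModType R)
    (phi : E -> R^o) (x v : E) (s : R) :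
  differentiable phi (x + s *: v) ->
  is_derive s (1 : R) (fun t : R => phi (x + t *: v) : R)
    ('d phi (x + s *: v) v).
Proof.
move=> dphi.
have dline : is_diff s (fun t : R => x + t *: v) (fun t : R => t *: v).
  by apply: is_diff_eq; apply/funext => t /=; rewrite /cst /= add0r.
have ddline : differentiable (fun t : R => x + t *: v) s by [].
have dcomp := differentiable_comp ddline dphi.
split; first exact: diff_derivable.
by rewrite deriveE // diff_comp //= diff_val scale1r.
Qed.

(** The mean value theorem on the segment from [x] to [y] gives
    [phi y - phi x = 'd phi z (y - x)] for some [z] in the ball, where the
    differential is within [e] of ['d phi u].  Differentiability at [u] alone
    would compare with [phi u] only, whereas both ends move when a curve is
    perturbed. *)
Lemma C1_strict_differentiability (R : realType) (E : normedModType R)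
    (phi : E -> R^o) (u : E) (e : R) :
  C1 phi -> 0 < e ->
  exists2 r, 0 < r & forall x y, ball u r x -> ball u r y ->
    `|phi y - phi x - 'd phi u (y - x)| <= e * `|y - x|.
Proof.
move=> [dphi cphi] e0; have /nbhs_ballP[r /= r0 near_u] := cphi u e e0.
exists r => // x y ux uy.
pose f (t : R) : R := phi (x + t *: (y - x)).
pose df (t : R) : R := 'd phi (x + t *: (y - x)) (y - x).
have fdf t : is_derive t (1 : R) f (df t).
  exact/is_derive_along_segment/dphi.
have cf : {within `[0, 1], continuous f}.
  apply: continuous_subspaceT => t.
  apply: differentiable_continuous; apply/derivable1_diffP.
  exact: (@ex_derive _ _ _ _ _ _ _ (fdf t)).
have [c c01] := MVT ltr01 (fun t _ => fdf t) cf.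
have -> : f 0 = phi x by rewrite /f scale0r addr0.
have -> : f 1 = phi y by rewrite /f scale1r addrC subrK.
move=> ->.
rewrite subr0 mulr1; apply: near_u.
move: c01; rewrite in_itv /= => /andP[c0 c1].
rewrite -ball_normE /=.
have -> : u - (x + c *: (y - x)) = (1 - c) *: (u - x) + c *: (u - y).
  have -> : y - x = (u - x) - (u - y) by rewrite opprB [RHS]addrC subrKA.
  by rewrite opprD addrA scalerBr opprB addrA scalerBl scale1r addrAC.
rewrite (le_lt_trans (ler_normD _ _)) // !normrZ ger0_norm ?subr_ge0 ?ltW //.
rewrite ger0_norm ?ltW //.
move: ux uy; rewrite -!ball_normE /= => ux uy; nra.
Qed.

(** * Moving along the sphere *)

Section Sphere.
Variables (R : realType) (E H : normedModType R).
Variables (ip : {dot H for idfun}) (j : {linear E -> H}).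
Hypothesis ip_norm : forall x : H, ip x x = `|x| ^+ 2.
Hypothesis j_cont : continuous j.

Lemma dotC (x y : H) : ip x y = ip y x.
Proof. by rewrite hermC expr0 mul1r. Qed.

Lemma sqr_normD (x y : H) : `|x + y| ^+ 2 = `|x| ^+ 2 + 2 * ip x y + `|y| ^+ 2.
Proof.
rewrite -!ip_norm linearDl /= !linearDr /= (dotC y x); ring.
Qed.

(** By polarization, from continuity of the norm. *)
Lemma continuous_dotl (y : H) : continuous (ip^~ y).
Proof.
have -> : ip^~ y = fun x => 2^-1 * (`|x + y| ^+ 2 - `|x| ^+ 2 - `|y| ^+ 2).
  by apply/funext => x; rewrite sqr_normD; field.
move=> x; apply: cvgMr; apply: cvgB; last exact: cvg_cst.
have sqr_cvg (T : Type) (F : set_system T) (FF : Filter F) (f : T -> H) l :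
    f @ F --> l -> (`|f t| ^+ 2) @[t --> F] --> `|l| ^+ 2.
  by move=> fl; apply: cvgM; apply: cvg_norm.
apply: cvgB; apply: sqr_cvg; last exact: cvg_id.
by apply: cvgD; [exact: cvg_id | exact: cvg_cst].
Qed.

Lemma norm_add_tangent (u v : E) (h : R) : sphere j u -> tangent ip j u v ->
  `|j (u + h *: v)| ^+ 2 = 1 + h ^+ 2 * `|j v| ^+ 2.
Proof.
rewrite /sphere /tangent /= => ju juv; rewrite linearD linearZ /= sqr_normD ju.
by rewrite linearZr_LR /= juv normrZ exprMn real_normK ?num_real //; ring.
Qed.

(** By Pythagoras, moving tangentially does not decrease the norm in [H], so the
    radial retraction of the moved point never divides by zero, whatever the
    size of [h]. *)
Lemma norm_add_tangent_ge1 (u v : E) (h : R) : sphere j u -> tangent ip j u v ->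
  1 <= `|j (u + h *: v)|.
Proof.
move=> ju juv; rewrite -(@ler_pXn2r _ 2) // ?nnegrE //.
by rewrite norm_add_tangent // expr1n lerDl mulr_ge0 // sqr_ge0.
Qed.

Definition radial_retraction (x : E) : E := `|j x|^-1 *: x.

Lemma sphere_radial_retraction (x : E) : 0 < `|j x| ->
  sphere j (radial_retraction x).
Proof.
move=> jx0; rewrite /sphere /radial_retraction /= linearZ /= normrZ.
by rewrite normfV normr_id mulVf // gt_eqF.
Qed.

(** The limit is taken jointly in the time [t] and the size [h] of the
    displacement, which is what makes the estimates drawn from it uniform in
    [t].  With [N] the norm before retraction, the quotient equals
    [N^-1 *: (w t - ((N - 1) / h) *: g t)], where [N - 1] is of order
    [h ^+ 2]. *)
Lemma radial_retraction_velocity (g w : R -> E) (t0 : R) :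
  {for t0, continuous g} -> {for t0, continuous w} ->
  (forall t, sphere j (g t)) -> (forall t, tangent ip j (g t) (w t)) ->
  (z.2^-1 *: (radial_retraction (g z.1 + z.2 *: w z.1) - g z.1))
    @[z --> (nbhs t0, 0^'+)] --> w t0.
Proof.
move=> cg cw Mg Tw.
pose F := filter_prod (nbhs t0) (0^'+ : set_system R).
have z1 : (fun z : R * R => z.1) @ F --> t0 by exact: cvg_fst.
have z2 : (fun z : R * R => z.2) @ F --> (0 : R).
  exact: (@cvg_comp _ _ _ _ id _ _ _
    (@cvg_snd _ _ _ _ _) (@cvg_within _ _ _ _)).
have z2gt0 : \forall z \near F, 0 < z.2 by exact: (cvg_snd (nbhs_right_gt 0)).
have gz : (fun z : R * R => g z.1) @ F --> g t0 by exact: (cvg_comp _ _ z1 cg).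
have wz : (fun z : R * R => w z.1) @ F --> w t0 by exact: (cvg_comp _ _ z1 cw).
pose N (z : R * R) := `|j (g z.1 + z.2 *: w z.1)|.
have jw0 : (fun z : R * R => z.2 * `|j (w z.1)| ^+ 2) @ F --> (0 : R).
  rewrite -[X in _ --> X](mul0r (`|j (w t0)| ^+ 2)).
  have jwz : (fun z : R * R => j (w z.1)) @ F --> j (w t0).
    by have := cvg_comp _ _ wz (@j_cont (w t0)); exact.
  by apply: cvgM => //; apply: cvgM; apply: cvg_norm.
(* Since [1 <= N], the excess [N - 1] is at most [N ^+ 2 - 1], which equals
   [z.2 ^+ 2 * `|j (w z.1)| ^+ 2] by tangency. *)
have Nb (z : R * R) :
    0 < z.2 -> 0 <= (N z - 1) / z.2 <= z.2 * `|j (w z.1)| ^+ 2.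
  move=> h0; have N1 := norm_add_tangent_ge1 z.2 (Mg z.1) (Tw z.1).
  apply/andP; split; first by apply: divr_ge0; [rewrite subr_ge0 | exact: ltW].
  rewrite ler_pdivrMr //; have := norm_add_tangent z.2 (Mg z.1) (Tw z.1).
  by rewrite -/(N z) in N1 *; nra.
have N0 : (fun z => (N z - 1) / z.2) @ F --> (0 : R).
  apply: (squeeze_cvgr _ (cvg_cst 0) jw0).
  by apply: filterS z2gt0 => z /Nb.
have N1 : N @ F --> (1 : R).
  rewrite -[X in _ --> X](add0r 1) -[X in _ --> X + _](mul0r 0).
  have : (fun z => (N z - 1) / z.2 * z.2 + 1) @ F --> (0 * 0 + 1 : R).
    by apply: cvgD; [exact: cvgM | exact: cvg_cst].
  apply: cvg_trans; apply: near_eq_cvg; apply: filterS z2gt0 => z h0.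
  by rewrite divfK ?gt_eqF // subrK.
rewrite -[X in _ --> X]scale1r -[X in _ --> _ *: X]subr0.
rewrite -[X in _ --> _ *: (_ - X)](scale0r (g t0)).
rewrite -[X in _ --> X *: _]invr1.
have : (fun z : R * R => (N z)^-1 *: (w z.1 - ((N z - 1) / z.2) *: g z.1)) @ F
    --> 1^-1 *: (w t0 - 0 *: g t0).
  apply: cvgZ; first by apply: cvgV => //; exact: oner_neq0.
  by apply: cvgB => //; exact: cvgZ.
apply: cvg_trans; apply: near_eq_cvg; apply: filterS z2gt0 => z h0.
have Nn0 : N z != 0.
  by rewrite gt_eqF // (lt_le_trans ltr01) //; exact: norm_add_tangent_ge1.
rewrite /radial_retraction -/(N z).
apply: (@scalerI _ _ (N z * z.2)); first by rewrite mulf_neq0 // gt_eqF.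
have z2n0 : z.2 != 0 by rewrite gt_eqF.
have e1 : N z * z.2 * (N z)^-1 = z.2 by rewrite mulrAC divff // mul1r.
have e2 : N z * z.2 * z.2^-1 = N z by rewrite mulfK.
rewrite [LHS]scalerA [RHS]scalerA e1 e2 !scalerBr !scalerA divff // scale1r.
rewrite mulrCA divff // mulr1 scalerBl scale1r.
by rewrite opprB addrA (addrC (z.2 *: _)).
Qed.

(** By compactness it suffices to treat times near a fixed [t0] and small [h].
    If [phi (g t0) < P], continuity is enough.  Otherwise the displacement of
    the curve is [h *: q] with [q] close to [w t0], and strict
    differentiability at [g t0] shows that [phi] drops by nearly
    [- h * 'd phi (g t0) (w t0)], which is more than [m * h]; half of it
    absorbs the error. *)
Lemma perturbed_path_descent (phi : E -> R^o) (g w : R -> E) (P m : R) :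
  C1 phi -> 0 < m -> continuous g -> continuous w ->
  (forall t, sphere j (g t)) -> (forall t, tangent ip j (g t) (w t)) ->
  (forall t, phi (g t) <= P) -> (forall t, `|w t| < 2) ->
  (forall t, phi (g t) = P -> 'd phi (g t) (w t) < - m) ->
  \forall h \near 0^'+, forall t, 0 <= t <= 1 ->
    `|radial_retraction (g t + h *: w t) - g t| <= 2 * h /\
    phi (radial_retraction (g t + h *: w t)) <= P - m / 2 * h.
Proof.
move=> phiC1 m0 cg cw Mg Tw phiP w2 Dw.
have /compact_near_coveringP cov := @segment_compact R 0 1.
have := cov R 0^'+ (fun h t =>
    `|radial_retraction (g t + h *: w t) - g t| <= 2 * h /\
    phi (radial_retraction (g t + h *: w t)) <= P - m / 2 * h) _.
have FF : Filter (0^'+ : set_system R) by exact: at_right_proper_filter.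
move=> /(_ FF) [] //; last first.
  by move=> e /= e0 He; exists e => // h he h0 t t01; exact: He.
move=> t0 _ {FF cov}.
have qw := radial_retraction_velocity (cg t0) (cw t0) Mg Tw.
set q := (fun z : R * R => _) in qw.
pose y (z : R * R) := g z.1 + z.2 *: q z.
pose F := filter_prod (nbhs t0) (0^'+ : set_system R).
have z1 : (fun z : R * R => z.1) @ F --> t0 by exact: cvg_fst.
have z2 : (fun z : R * R => z.2) @ F --> (0 : R).
  exact: (@cvg_comp _ _ _ _ id _ _ _
    (@cvg_snd _ _ _ _ _) (@cvg_within _ _ _ _)).
have z2gt0 : \forall z \near F, 0 < z.2 by exact: (cvg_snd (nbhs_right_gt 0)).
have gz : (fun z : R * R => g z.1) @ F --> g t0.
  exact: (cvg_comp _ _ z1 (cg t0)).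
have yg : y @ F --> g t0.
  rewrite -[X in _ --> X]addr0 -[X in _ --> _ + X](scale0r (w t0)).
  by apply: cvgD => //; exact: cvgZ.
have q2 : \forall z \near F, `|q z| < 2.
  by apply: (cvgr_norm_lt _ qw); exact: w2.
have retrE (z : R * R) : 0 < z.2 ->
    radial_retraction (g z.1 + z.2 *: w z.1) = y z.
  by move=> h0; rewrite /y /q scalerA divff ?gt_eqF // scale1r [RHS]addrC subrK.
suff phiy : \forall z \near F, phi (y z) <= P - m / 2 * z.2.
  change (\forall z \near F,
    `|radial_retraction (g z.1 + z.2 *: w z.1) - g z.1| <= 2 * z.2 /\
    phi (radial_retraction (g z.1 + z.2 *: w z.1)) <= P - m / 2 * z.2).
  near=> z.
  have h0 : 0 < z.2 by near: z.
  have qz2 : `|q z| < 2 by near: z.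
  rewrite retrE //; split; last by near: z.
  by rewrite addrAC subrr add0r normrZ gtr0_norm // mulrC ler_pM2r // ltW.
have [phit0|] := eqVneq (phi (g t0)) P; last first.
  move=> neP; have ltP : phi (g t0) < P by rewrite lt_neqAle neP phiP.
  have phi_cont : {for g t0, continuous phi}.
    exact/differentiable_continuous/(proj1 phiC1).
  have lim : (fun z => (phi (y z) : R) + m / 2 * z.2) @ F -->
      (phi (g t0) : R) + m / 2 * 0.
    apply: cvgD; first by have := cvg_comp _ _ yg phi_cont; exact.
    by apply: cvgMr.
  have : \forall z \near F, (phi (y z) : R) + m / 2 * z.2 < P.
    by apply: (cvgr_lt _ lim); rewrite mulr0 addr0.
  by apply: filterS => z /ltW; rewrite lerBrDr.
(* An error [m / 4] per unit length costs at most [m / 2 * z.2], because the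
   displacement has length at most [2 * z.2]. *)
have m4 : 0 < m / 4 by rewrite divr_gt0.
have [r r0 strict] := C1_strict_differentiability (g t0) phiC1 m4.
have Dcont : continuous ('d phi (g t0)).
  exact/diff_continuous/(proj1 phiC1).
have Dq : (fun z => 'd phi (g t0) (q z) : R) @ F --> ('d phi (g t0) (w t0) : R).
  by have := cvg_comp _ _ qw (Dcont (w t0)); exact.
have Dqm : \forall z \near F, ('d phi (g t0) (q z) : R) < - m.
  by apply: (cvgr_lt _ Dq); exact: Dw.
have ballg : \forall z \near F, ball (g t0) r (g z.1).
  by apply: gz; exact: nbhsx_ballx.
have bally : \forall z \near F, ball (g t0) r (y z).
  by apply: yg; exact: nbhsx_ballx.
near=> z.
have h0 : 0 < z.2 by near: z.
have qz2 : `|q z| < 2 by near: z.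
have Dz : ('d phi (g t0) (q z) : R) < - m by near: z.
have gr : ball (g t0) r (g z.1) by near: z.
have yr : ball (g t0) r (y z) by near: z.
have := strict _ _ gr yr.
rewrite {2 3}/y [g z.1 + _]addrC addrK.
rewrite linearZ /= normrZ gtr0_norm // ler_distl => /andP[_].
have h1 : z.2 * ('d phi (g t0) (q z) : R) <= z.2 * - m.
  by rewrite ler_pM2l // ltW.
have h2 : m / 4 * (z.2 * `|q z|) <= m / 4 * (z.2 * 2).
  by rewrite !ler_pM2l // ltW.
have := phiP z.1; rewrite /GRing.scale /=.
move: (phi (y z) : R) (phi (g z.1) : R) (z.2 * _ : R)
  (m / 4 * (z.2 * `|q z|)) h1 h2.
move=> b a c d; lra.
Unshelve. all: by end_near.
Qed.

End Sphere.

(** * Curves on the sphere with fixed endpoints *)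

Lemma ltr_convex_comb (R : realFieldType) (a b c l : R) :
  a < c -> b < c -> 0 <= l <= 1 -> (1 - l) * a + l * b < c.
Proof.
move=> ac bc /andP[]; rewrite le_eqVlt => /predU1P[<- _|l0 l1].
  by rewrite subr0 mul1r mul0r addr0.
have h1 : (1 - l) * a <= (1 - l) * c by rewrite ler_wpM2l ?subr_ge0 // ltW.
have h2 : l * b < l * c by rewrite ltr_pM2l.
by have := ler_ltD h1 h2; rewrite -mulrDl subrK mul1r.
Qed.

Section Paths.
Variables (R : realType) (E : completeNormedModType R) (H : normedModType R).
Variables (ip : {dot H for idfun}) (j : {linear E -> H}).
Hypothesis ip_norm : forall x : H, ip x x = `|x| ^+ 2.
Hypothesis j_cont : continuous j.
Variable phi : E -> R^o.
Hypothesis phiC1 : C1 phi.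

Lemma C1_continuous : continuous (phi : E -> R).
Proof. by move=> u; apply: differentiable_continuous; exact: (proj1 phiC1). Qed.

Definition path_max (g : R -> E) : R :=
  sup [set (phi (g t) : R) | t in `[0, 1]].

Lemma path_max_ge (g : R -> E) (t : R) : continuous g -> 0 <= t <= 1 ->
  phi (g t) <= path_max g.
Proof.
move=> cg t01.
have cphig : {within `[0, 1], continuous (fun s => phi (g s) : R)}.
  apply: continuous_subspaceT => s.
  exact: (continuous_comp (cg s) (@C1_continuous (g s))).
have [c _ maxc] := EVT_max ler01 cphig.
apply: ub_le_sup; last by exists t.
by exists (phi (g c)) => _ [s s01 <-]; exact: maxc.
Qed.

Lemma path_max_le (g : R -> E) (M : R) :
  (forall t, 0 <= t <= 1 -> phi (g t) <= M) -> path_max g <= M.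
Proof.
move=> gM; apply: ge_sup.
  by exists (phi (g 0)), 0; rewrite //= in_itv /= lexx ler01.
by move=> _ [t t01 <-]; apply: gM.
Qed.

(** Curves are defined and continuous on the whole line, and constant outside
    the unit interval; this avoids one-sided continuity at 0 and 1. *)
Definition curves (p q : E) : set (R -> E) :=
  [set g : R -> E | [/\ continuous g, (forall t, sphere j (g t)),
              (forall t, t <= 0 -> g t = p) & (forall t, 1 <= t -> g t = q)]].

(** The order of Ekeland's principle: [f] improves on [g] at a rate at least
    [k] for the uniform distance.  The pointwise form spares the definition of
    that distance, and transitivity is the triangle inequality. *)
Definition path_order (k : R) (f g : R -> E) : Prop :=
  forall t, `|f t - g t| <= (path_max g - path_max f) / k.

Lemma path_order_refl k g : path_order k g g.
Proof. by move=> t; rewrite !subrr normr0 mul0r. Qed.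

Lemma path_order_trans k g f h :
  path_order k f g -> path_order k g h -> path_order k f h.
Proof.
move=> fg gh t; rewrite -(subrKA (g t)) (le_trans (ler_normD _ _)) //.
rewrite (le_trans (lerD (fg t) (gh t))) // -mulrDl addrC.
by rewrite addrA subrK.
Qed.

Lemma path_order_max k f g : 0 < k -> path_order k f g ->
  path_max f <= path_max g.
Proof.
move=> k0 /(_ 0) fg.
rewrite -subr_ge0 -(pmulr_lge0 _ (_ : 0 < k^-1)) ?invr_gt0 //.
exact: le_trans fg.
Qed.

Lemma curves_clamp (p q : E) (g : R -> E) (t : R) :
  curves p q g -> g (clamp01 t) = g t.
Proof.
move=> [_ _ g0 g1].
have [t0|t0] := leP t 0; first by rewrite clamp01_le0 // !g0.
have [t1|t1] := leP 1 t; first by rewrite clamp01_ge1 // !g1.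
by rewrite clamp01_id // !ltW.
Qed.

Lemma curves_le_path_max (p q : E) (g : R -> E) (t : R) :
  curves p q g -> phi (g t) <= path_max g.
Proof.
move=> Cg; rewrite -(curves_clamp t Cg); apply: path_max_ge.
  by case: Cg.
exact: clamp01_itv.
Qed.

(** Along a descending chain the maxima decrease to a limit [L], and
    [(path_max (u n) - L) / k] bounds all later uniform distances to [u n].
    The chain is therefore uniformly Cauchy; its limit is again a curve, with
    maximum at most [L] because [phi] is continuous. *)
Lemma curves_chain_complete (p q : E) (a k : R) (u : nat -> R -> E) :
  0 < k -> (forall g, curves p q g -> a <= path_max g) ->
  (forall n, curves p q (u n)) -> (forall n, path_order k (u n.+1) (u n)) ->
  exists2 f, curves p q f & forall n, path_order k f (u n).
Proof.
move=> k0 age Cu ordu.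
have ord n m : (n <= m)%N -> path_order k (u m) (u n).
  move=> /subnK <-; elim: (m - n)%N => [|d IH]; first exact: path_order_refl.
  exact: path_order_trans (ordu _) IH.
pose M n := path_max (u n).
have M_anti n m : (n <= m)%N -> M m <= M n by move=> /ord /(path_order_max k0).
pose L := inf (range M).
have hasL : has_inf (range M).
  split; first by exists (M 0%N), 0%N.
  by exists a => _ [n _ <-]; exact: age.
have LM n : L <= M n by apply: ge_inf; [case: hasL | exists n].
have small e : 0 < e -> exists n, (M n - L) / k < e.
  move=> e0; have [_ [n _ <-] Mn] := inf_adherent (mulr_gt0 e0 k0) hasL.
  by exists n; rewrite ltr_pdivrMr // ltrBlDl.
have close n m t : (n <= m)%N -> `|u m t - u n t| <= (M n - L) / k.
  move=> /ord /(_ t) /le_trans; apply; rewrite ler_pM2r ?invr_gt0 //.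
  by rewrite lerD2l lerN2; exact: LM.
have cvgu t : cvg ((u n t) @[n --> \oo]).
  apply: cauchy_cvg; apply: cauchy_exP => e /small [n Mn].
  exists (u n t); exists n => // m nm; rewrite /= -ball_normE /= distrC.
  exact: le_lt_trans (close _ _ _ nm) Mn.
pose f t := lim ((u n t) @[n --> \oo]).
have uf t : (u n t) @[n --> \oo] --> f t by exact: cvgu.
have fu n t : `|f t - u n t| <= (M n - L) / k.
  have : `|u m t - u n t| @[m --> \oo] --> `|f t - u n t|.
    by apply: cvg_norm; apply: cvgB; [exact: uf | exact: cvg_cst].
  move=> /cvgr_to_le; apply; exists n => // m nm; exact: close.
have cf : continuous f.
  move=> t; apply/cvgrPdist_lt => e e0.
  have e3 : 0 < e / 3 by rewrite divr_gt0.
  have [n Mn] := small _ e3.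
  have [cun _ _ _] := Cu n.
  have : \forall s \near t, `|u n t - u n s| < e / 3.
    exact: (cvgr_dist_lt _ _ (cun t)).
  apply: filterS => s us.
  have -> : f t - f s = (f t - u n t) + (u n t - u n s) - (f s - u n s).
    by rewrite opprB -addrA subrKA subrKA.
  have h1 := fu n t; have h2 := fu n s.
  apply: le_lt_trans (ler_normB _ _) _.
  have := ler_normD (f t - u n t) (u n t - u n s).
  move: h1 h2 us Mn; lra.
have fmax : path_max f <= L.
  apply: path_max_le => t t01; apply: lb_le_inf; first by case: hasL.
  move=> _ [n _ <-].
  have : (phi (u m t) : R) @[m --> \oo] --> (phi (f t) : R).
    by have := cvg_comp _ _ (uf t) (@C1_continuous (f t)); exact.
  move=> /cvgr_to_le; apply; exists n => // m nm /=.
  apply: le_trans (M_anti _ _ nm); apply: path_max_ge => //.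
  by case: (Cu m).
exists f.
  split=> // [t|t t0|t t1].
  - have ju : (fun n => `|j (u n t)|) @ \oo --> `|j (f t)|.
      by apply: cvg_norm; have := cvg_comp _ _ (uf t) (@j_cont (f t)); exact.
    have e1 : (fun n => `|j (u n t)|) = fun=> 1.
      by apply/funext => n; case: (Cu n) => _ /(_ t).
    by rewrite e1 in ju; apply: (norm_cvg_unique ju); exact: cvg_cst.
  - have ep : (fun n => u n t) = fun=> p.
      by apply/funext => n; case: (Cu n) => _ _ /(_ t t0).
    by rewrite /f ep lim_cst //; exact: norm_hausdorff.
  - have eq : (fun n => u n t) = fun=> q.
      by apply/funext => n; case: (Cu n) => _ _ _ /(_ t t1).
    by rewrite /f eq lim_cst //; exact: norm_hausdorff.
move=> n t; apply: le_trans (fu n t) _.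
by rewrite ler_pM2r ?invr_gt0 // lerD2l lerN2.
Qed.

(** The requirements on [w t] define a convex set.  Near a time where
    [phi (g t) != P] the zero field meets them.  Near a time where
    [phi (g t) = P], which is interior to the interval as [p] and [q] are below
    [P], so does the steep vector [v] there, projected on the moving tangent
    space by [v - ip (j (g t)) (j v) *: g t]; this stays in [E] since [g t]
    does. *)
Lemma tangent_descent_field (p q : E) (g : R -> E) (P m : R) :
  curves p q g -> phi p < P -> phi q < P ->
  (forall t, phi (g t) = P ->
     exists v, [/\ tangent ip j (g t) v, `|v| = 1 & 'd phi (g t) v < - m]) ->
  exists w : R -> E, [/\ continuous w,
    (forall t, tangent ip j (g t) (w t) /\ `|w t| < 2),
    (forall t, phi (g t) = P -> 'd phi (g t) (w t) < - m),
    (forall t, t <= 0 -> w t = 0) & (forall t, 1 <= t -> w t = 0)].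
Proof.
move=> Cg phip phiq steep; have [cg Mg g0 g1] := Cg.
pose G (t : R) := [set w : E | [/\ tangent ip j (g t) w, `|w| < 2,
  phi (g t) = P -> 'd phi (g t) w < - m & t <= 0 \/ 1 <= t -> w = 0]].
have phig : continuous (fun t => phi (g t) : R).
  by move=> t; exact: (continuous_comp (cg t) (@C1_continuous (g t))).
have [||w cw Gw] := @continuous_convex_selection _ E G 0 1.
- move=> t x y l [Tx x2 Dx x0] [Ty y2 Dy y0] l01; split.
  + move: Tx Ty; rewrite /tangent /= => Tx Ty.
    rewrite linearD !linearZ /= linearDr /= !linearZr_LR /= Tx Ty.
    by rewrite !mulr0 addr0.
  + rewrite (le_lt_trans (ler_normD _ _)) // !normrZ.
    have /andP[l0 l1] := l01; rewrite !ger0_norm ?subr_ge0 //.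
    exact: ltr_convex_comb.
  + move=> gP; rewrite linearD !linearZ /=.
    exact: ltr_convex_comb (Dx gP) (Dy gP) l01.
  + by move=> t01; rewrite x0 // y0 // !scaler0 addr0.
- move=> t0; have [gP|gP] := eqVneq (phi (g t0) : R) P; last first.
    exists (fun=> 0); first by move=> ?; exact: cvg_cst.
    have : \forall t \near t0, (phi (g t) : R) != P.
      have diff0 : \forall t \near t0, (phi (g t) : R) - P != 0.
        have lim : ((phi (g t) : R) - P) @[t --> t0] --> (phi (g t0) : R) - P.
          by apply: cvgB; [exact: phig | exact: cvg_cst].
        by apply: (cvgr_neq0 _ lim); rewrite subr_eq0.
      by apply: filterS diff0 => t; rewrite subr_eq0.
    apply: filterS => t gtP; split=> //.
    + by rewrite /tangent /= linear0 linear0r.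
    + by rewrite normr0.
    + by move=> gtP'; rewrite gtP' eqxx in gtP.
  have t00 : 0 < t0.
    rewrite ltNge; apply/negP => /g0 gp.
    by rewrite gp in gP; rewrite gP ltxx in phip.
  have t01 : t0 < 1.
    rewrite ltNge; apply/negP => /g1 gp.
    by rewrite gp in gP; rewrite gP ltxx in phiq.
  have [v [Tv v1 Dv]] := steep t0 gP.
  pose V t := v - ip (j (g t)) (j v) *: g t.
  have cV : continuous V.
    move=> t; apply: cvgB; first exact: cvg_cst.
    apply: cvgZ; last exact: cg.
    have cjg := continuous_comp (cg t) (@j_cont (g t)).
    exact: (continuous_comp cjg (@continuous_dotl _ _ _ ip_norm (j v) _)).
  have V0 : V t0 = v by rewrite /V (_ : ip _ _ = 0) // scale0r subr0.
  exists V => //.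
  (* A quarter of the gap [d] is spent on the variation of the differential,
     with a factor 2 from the norm of [V t], and a half is left for that of
     [V] itself. *)
  pose d := - m - 'd phi (g t0) v : R.
  have d0 : 0 < d by rewrite subr_gt0.
  have d4 : 0 < d / 4 by rewrite divr_gt0.
  have nV : \forall t \near t0, `|V t| < 2.
    by apply: (cvgr_norm_lt _ (cV t0)); rewrite V0 v1 ltr1n.
  have nD : \forall t \near t0, forall z : E,
      `|'d phi (g t) z - 'd phi (g t0) z| <= d / 4 * `|z|.
    exact: (cg t0 _ (proj2 phiC1 (g t0) _ d4)).
  have Dcont : continuous ('d phi (g t0)).
    exact/diff_continuous/(proj1 phiC1).
  have nD0 : \forall t \near t0, ('d phi (g t0) (V t) : R) < - m - d / 2.
    apply: (cvgr_lt _ (continuous_comp (cV t0) (Dcont (V t0)))).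
    rewrite /= V0; move: d0; rewrite /d.
    move: ('d phi (g t0) v : R) => a; lra.
  near=> t.
  split.
  + rewrite /tangent /= /V linearB linearZ /= linearBr /= linearZr_LR /=.
    by rewrite ip_norm (Mg t) expr1n mulr1 subrr.
  + by near: t.
  + move=> _.
    have nVt : `|V t| < 2 by near: t.
    have nD0t : ('d phi (g t0) (V t) : R) < - m - d / 2 by near: t.
    have : forall z : E, `|'d phi (g t) z - 'd phi (g t0) z| <= d / 4 * `|z|.
      by near: t.
    move=> /(_ (V t)); rewrite ler_distl => /andP[_].
    have : d / 4 * `|V t| <= d / 4 * 2 by rewrite ler_pM2l // ltW.
    move: ('d phi (g t) (V t) : R) ('d phi (g t0) (V t) : R) nD0t => a b.
    move: (d / 4 * `|V t|) => c; lra.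
  + have ht0 : 0 < t by near: t; exact: lt_nbhsr.
    have ht1 : t < 1 by near: t; exact: lt_nbhsl.
    by case; rewrite leNgt ?ht0 ?ht1.
have {}Gw t : G (clamp01 t) (w (clamp01 t)) by apply: Gw; exact: clamp01_itv.
exists (fun t => w (clamp01 t)); split.
- by move=> t; exact: (continuous_comp (@continuous_clamp01 R t) (cw _)).
- by move=> t; case: (Gw t); rewrite (curves_clamp t Cg).
- by move=> t gP; case: (Gw t); rewrite (curves_clamp t Cg) => _ _ /(_ gP).
- by move=> t t0; case: (Gw t) => _ _ _; apply; left; rewrite clamp01_le0.
- by move=> t t1; case: (Gw t) => _ _ _; apply; right; rewrite clamp01_ge1.
Unshelve. all: by end_near.
Qed.

Lemma curves_perturbed (p q : E) (g w : R -> E) (h : R) :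
  curves p q g -> continuous w -> (forall t, tangent ip j (g t) (w t)) ->
  (forall t, t <= 0 -> w t = 0) -> (forall t, 1 <= t -> w t = 0) ->
  curves p q (fun t => radial_retraction j (g t + h *: w t)).
Proof.
move=> [cg Mg g0 g1] cw Tw w0 w1.
have N1 t := norm_add_tangent_ge1 ip_norm h (Mg t) (Tw t).
have N0 t : 0 < `|j (g t + h *: w t)| by exact: lt_le_trans ltr01 (N1 t).
have retr_id t : w t = 0 -> radial_retraction j (g t + h *: w t) = g t.
  move=> ->; rewrite scaler0 addr0 /radial_retraction.
  by have -> := Mg t; rewrite invr1 scale1r.
split=> [t|t|t t0|t t1].
- have cz : (fun s => g s + h *: w s) @ t --> g t + h *: w t.
    by apply: cvgD; [exact: cg | apply: cvgZr; exact: cw].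
  apply: cvgZ => //; apply: cvgV; first by rewrite gt_eqF.
  by apply: cvg_norm; have := cvg_comp _ _ cz (@j_cont _); exact.
- exact: sphere_radial_retraction.
- by rewrite retr_id ?w0 // g0.
- by rewrite retr_id ?w1 // g1.
Qed.

Lemma steep_tangent (u : E) (m : R) :
  (m%:E < norm_constrained_diff ip j phi u)%E ->
  exists v, [/\ tangent ip j u v, `|v| = 1 & 'd phi u v < - m].
Proof.
move=> /ereal_sup_gt[_ [v [Tv v1] <-]]; rewrite lte_fin.
have [Dv|Dv] := leP 0 ('d phi u v : R).
  rewrite ger0_norm // => mD; exists (- v); split.
  - by move: Tv; rewrite /tangent /= linearN linearNr /= => ->; rewrite oppr0.
  - by rewrite normrN.
  - by rewrite linearN ltrN2.
by rewrite ltr0_norm // ltrNr => mD; exists v.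
Qed.

Lemma curves_of_path (theta : R) (Y : set E) (g : R -> E) :
  paths j phi theta Y g -> curves (g 0) (g 1) (fun t => g (clamp01 t)).
Proof.
move=> [/subspace_continuousP cg Mg _ _]; split=> [t|t|t t0|t t1].
- move=> B gB; have := cg (clamp01 t) _ _ gB.
  rewrite /= in_itv /= clamp01_itv => /(_ isT) near_cl.
  have Bcl : \forall s \near t,
      `[0, 1]%classic (clamp01 s) -> B (g (clamp01 s)).
    exact: (@continuous_clamp01 R t _ near_cl).
  change (\forall s \near t, B (g (clamp01 s))).
  apply: filterS Bcl => s; apply.
  by rewrite /= in_itv /= clamp01_itv.
- by apply: Mg; exact: clamp01_itv.
- by rewrite clamp01_le0.
- by rewrite clamp01_ge1.
Qed.

Lemma paths_of_curve (theta : R) (Y : set E) (p q : E) (g : R -> E) :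
  Y p -> phi q < theta -> curves p q g -> paths j phi theta Y g.
Proof.
move=> Yp qtheta [cg Mg g0 g1]; split=> //.
- exact: continuous_subspaceT.
- by rewrite g0.
- by rewrite g1.
Qed.

End Paths.

(** * The minimax theorem *)

Theorem theorem2p5 (R : realType) (E H : completeNormedModType R)
  (ip : {dot H for idfun})
  (ip_norm : forall x : H, ip x x = `|x| ^+ 2)
  (E_infdim : infinite_dimensional E) (H_infdim : infinite_dimensional H)
  (j : {linear E -> H})
  (j_cont : continuous j) (j_inj : injective j)
  (to_dual_inj : injective (to_dual ip j))
  (theta : R) (phi : E -> R^o) (phiC1 : C1 phi)
  (Y : set E) (Y_sub : Y `<=` sphere j)
  (Y_closed : closed (Y : set (subspace (sphere j)))) :
  let a := minimax_level j phi theta Y in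
  let b := endpoint_level j phi theta Y in
  (b < a)%E ->
  forall (eps delta : R) (gamma : R -> E),
    0 < eps -> (eps%:E < (a - b) * (2^-1)%:E)%E ->
    0 < delta ->
    paths j phi theta Y gamma ->
    (max_on_path phi gamma <= a + eps%:E)%E ->
    exists u : E,
      [/\ sphere j u,
          (a - (2 * eps)%:E <= (phi u)%:E <= a + (2 * eps)%:E)%E,
          (min_dist_path u gamma <= (2 * delta)%:E)%E &
          (norm_constrained_diff ip j phi u <= (8 * eps / delta)%:E)%E].
Proof.
move=> a b ba eps delta gamma eps0 _ delta0 Ggamma gamma_max.
pose p := gamma 0; pose q := gamma 1.
have [_ _ Yp qtheta] := Ggamma.
pose g0 := gamma \o @clamp01 R.
have Cg0 : curves j p q g0 := curves_of_path Ggamma.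
have a_max g : curves j p q g -> (a <= (path_max phi g)%:E)%E.
  move=> Cg; have Gg := paths_of_curve Yp qtheta Cg.
  apply: (@le_trans _ _ (max_on_path phi g)).
    by apply: ereal_inf_lbound; exists g.
  apply: ge_ereal_sup => _ [t _ <-]; rewrite lee_fin.
  exact (curves_le_path_max phiC1 t Cg).
have end_a : ((Num.max (phi p) (phi q))%:E < a)%E.
  by apply: le_lt_trans ba; apply: ereal_sup_ubound; exists gamma.
have [r ar] : exists r : R, a = r%:E.
  have := a_max _ Cg0; move: end_a.
  case: a {ba gamma_max a_max} => [r _ _|//|//].
  by exists r.
rewrite ar in gamma_max a_max end_a *.
move: end_a; rewrite lte_fin gt_max => /andP[phip phiq].
have {}a_max g : curves j p q g -> r <= path_max phi g.
  by move=> /a_max; rewrite lee_fin.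
have g0_max : path_max phi g0 <= r + eps.
  apply: path_max_le => t t01; rewrite -lee_fin EFinD.
  apply: le_trans gamma_max; apply: ereal_sup_ubound.
  by exists t; rewrite ?in_itv //= /g0 /= clamp01_id.
(* An improvement by at most [eps] at a rate [k] moves the path by at most
   [2 * delta]. *)
pose k := eps / (2 * delta).
have k0 : 0 < k by rewrite divr_gt0 // mulr_gt0.
have [g [Cg gg0 g_min]] := brezis_browder
  (@path_order_refl _ _ phi k) (@path_order_trans _ _ phi k) a_max
  (fun f g => @path_order_max _ _ phi k f g k0)
  (fun u Cu => curves_chain_complete j_cont phiC1 k0 a_max Cu) Cg0.
pose P := path_max phi g; pose m := 8 * eps / delta.
have rP : r <= P := a_max _ Cg.
have Pr : P <= r + eps := le_trans (path_order_max k0 gg0) g0_max.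
have [cg Mg gl gr] := Cg.
have inner t : phi (g t) = P -> 0 <= t <= 1.
  move=> gP; apply/andP; split; rewrite leNgt; apply/negP => /ltW.
    by move=> /gl gp; move: phip; rewrite -gp gP ltNge rP.
  by move=> /gr gq; move: phiq; rewrite -gq gP ltNge rP.
have [[t [gP flat]]|steep] := pselect (exists t, phi (g t) = P /\
    (norm_constrained_diff ip j phi (g t) <= m%:E)%E).
  have t01 := inner _ gP.
  exists (g t); split=> //.
  - by rewrite gP -EFinB -EFinD !lee_fin; apply/andP; split; lra.
  - apply: (@le_trans _ _ (`|g t - gamma t|)%:E).
      by apply: ereal_inf_lbound; exists t; rewrite //= in_itv.
    rewrite lee_fin; have := gg0 t; rewrite /g0 /= clamp01_id // => /le_trans.
    apply; rewrite ler_pdivrMr // /k.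
    have -> : 2 * delta * (eps / (2 * delta)) = eps by field; rewrite gt_eqF.
    by rewrite -/P; lra.
exfalso.
have m0 : 0 < m by rewrite divr_gt0 // mulr_gt0.
have [|w [cw Tw Dw wl wr]] := tangent_descent_field ip_norm j_cont phiC1 Cg
  (lt_le_trans phip rP) (lt_le_trans phiq rP) (m := m).
  move=> t gP; apply: steep_tangent; rewrite ltNge; apply/negP => flat.
  by apply: steep; exists t.
have := perturbed_path_descent ip_norm j_cont phiC1 m0 cg cw Mg
  (fun t => proj1 (Tw t)) (fun t => curves_le_path_max phiC1 t Cg)
  (fun t => proj2 (Tw t)) Dw.
move=> /(filterI (nbhs_right_gt 0)) /filter_ex[h [/= h0 descent]].
pose gh t := radial_retraction j (g t + h *: w t).
have Cgh : curves j p q gh := curves_perturbed ip_norm j_cont h Cg cw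
  (fun t => proj1 (Tw t)) wl wr.
have gh_max : path_max phi gh <= P - m / 2 * h.
  by apply: path_max_le => t /descent[].
have h8 : 8 * h <= (P - path_max phi gh) / k.
  rewrite ler_pdivlMr //.
  have -> : 8 * h * k = m / 2 * h by rewrite /k /m; field; rewrite gt_eqF.
  by move: gh_max; lra.
suff : P <= path_max phi gh.
  have : 0 < m / 2 * h by rewrite mulr_gt0 // divr_gt0.
  by move: gh_max; lra.
apply: g_min => // t; apply: le_trans h8.
rewrite -(curves_clamp t Cgh) -(curves_clamp t Cg).
have [+ _] := descent _ (clamp01_itv t); move=> /le_trans; apply.
by rewrite ler_pM2r // ler_nat.
Qed.
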